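(* For every $n\ge 1$, the poset $\mathrm{Tub}(St_n)$ of tubings on the star graph $St_n$ is isomorphic to the poset, under the painted growth order, of painted trees with $n+1$ leaves consisting of forests of corollas grafted to weakly ordered trees.
   Context: **Tubings.** For a finite connected simple graph $G$, a tube is a nonempty set of nodes inducing a connected subgraph; the set of all nodes is the universal tube. Two tubes $u,v$ are compatible if one is contained in the other or if $u\cup v$ is not a tube (and $u,v$ disjoint). A tubing is a set of pairwise compatible tubes containing the universal tube. $\mathrm{Tub}(G)$ is the set of tubings ordered by $U\preceq U'$ iff $U'\subseteq U$. (It is the face poset of the graph associahedron $\mathcal{K}G$; $\mathcal{K}St_n$ is the stellohedron.) The star graph $St_n$ has nodes $0,1,\dots,n$ and edges $\{0,i\}$, $1\le i\le n$. **Plane and painted trees.** A plane tree is a finite rooted plane tree in which every node has at least two (linearly ordered) inputs; inputs not coming from another node are leaves, numbered $0,1,\dots,n$ from left to right; the root has an output edge. A node $w$ is strictly above a node $v$ if $v\neq w$ lies on the path from $w$ to the root. A weak order on a set of nodes is a total preorder (an ordered partition into levels), always required to satisfy: if $w$ is strictly above $v$ then the level of $w$ comes strictly after the level of $v$. A painted tree is a plane tree each of whose nodes is declared painted, half-painted or unpainted, such that if $w$ is strictly above $v$ and $v$ is half-painted or unpainted, then $w$ is unpainted. Let $W_n$ be the set of painted trees with $n+1$ leaves equipped with a weak order on the painted nodes and a weak order on all unpainted nodes. A forest of corollas grafted to a weakly ordered tree is a painted tree equipped with a weak order on the painted nodes, such that no unpainted node is strictly above another unpainted node; let $X_n$ be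 the set of those with $n+1$ leaves. The forgetful map $p:W_n\to X_n$ forgets the weak order of the unpainted nodes and contracts every edge joining two unpainted nodes. **Painted growth order.** For $t\in W_n$, gap $i$ ($1\le i\le n$) ends at the node where the paths from leaves $i-1$ and $i$ to the root first meet. $\pi(t)$ is the ordered partition of $\{0,\dots,n\}$ listing: in order, the blocks of gaps ending at painted nodes of each level; then the block of $0$ and all gaps ending at half-painted nodes; then, in order, the blocks of gaps ending at unpainted nodes of each level. $\pi(s)$ refines $\pi(t)$ if it is obtained by replacing each block by an ordered partition of that block. A growth step in $X_n$ (growing internal edges, then forgetting superfluous structure) passes from $x$ to $y$ if there are $t,s\in W_n$ with $p(t)=x$, $p(s)=y$ and $\pi(s)$ refining $\pi(t)$. Then $y\preceq x$ iff $y$ is obtained from $x$ by a finite (possibly empty) sequence of growth steps. *)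

(* Defs.v *)
From Stdlib Require Import Relations.
From mathcomp Require Import all_boot.

Set Implicit Arguments.
Unset Strict Implicit.
Unset Printing Implicit Defensive.

Definition poset_isomorphic (A B : Type) (leA : relation A) (leB : relation B) :
  Prop :=
  [/\ Relation_Definitions.order A leA, Relation_Definitions.order B leB &
      exists f : A -> B,
        bijective f /\ forall x y : A, leA x y <-> leB (f x) (f y)].

Definition induces_connected (T : finType) (e : rel T) (A : {set T}) : bool :=
  (A != set0) &&
  [forall x in A, forall y in A,
     connect [rel a b | [&& a \in A, b \in A & e a b]] x y].

Record cgraph := CGraph {
  vertex :> finType;
  edge : rel vertex;
  edge_sym : symmetric edge;
  edge_irrefl : irreflexive edge;
  graph_connected : induces_connected edge [set: vertex] }.

Section Tubings.
Variable G : cgraph.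

Definition tube (u : {set G}) : bool := induces_connected (@edge G) u.

Definition compatible (u v : {set G}) : bool :=
  [|| u \subset v, v \subset u | [disjoint u & v] && ~~ tube (u :|: v)].

Definition tubing (U : {set {set G}}) : bool :=
  [&& [forall u in U, tube u],
      [forall u in U, forall v in U, compatible u v]
    & [set: G] \in U].

Definition Tub := {U : {set {set G}} | tubing U}.

Definition tub_le (U U' : Tub) : Prop := val U' \subset val U.

End Tubings.

Definition star_edge (n : nat) : rel 'I_n.+1 :=
  [rel i j | (i == ord0) && (j != ord0) || (j == ord0) && (i != ord0)].

Lemma star_edge_sym n : symmetric (@star_edge n).
Proof. by move=> i j; rewrite /star_edge /= orbC. Qed.

Lemma star_edge_irrefl n : irreflexive (@star_edge n).
Proof. by move=> i; rewrite /star_edge /= andbN. Qed.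

Lemma star_connected n : induces_connected (@star_edge n) [set: 'I_n.+1].
Proof.
apply/andP; split; first by apply/set0Pn; exists ord0; rewrite inE.
set e' := [rel a b | _].
have to0 x : connect e' x ord0 /\ connect e' ord0 x.
  have [->|x0] := eqVneq x ord0; first by split; apply: connect0.
  by split; apply: connect1; rewrite /e' /star_edge /= !inE x0 ?eqxx ?orbT.
apply/forall_inP => x _; apply/forall_inP => y _.
exact: connect_trans (to0 x).1 (to0 y).2.
Qed.

Definition star (n : nat) : cgraph :=
  CGraph (@star_edge_sym n) (@star_edge_irrefl n) (star_connected n).

Inductive tree (L : Type) : Type :=
| Leaf : tree L
| Node : L -> seq (tree L) -> tree L.
Arguments Leaf {L}.

(* Nodes and leaves are addressed by the sequence of input positions leading  *)
(* to them from the root, so the path to the root runs through the prefixes   *)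
(* of the address.                                                            *)
Notation address := (seq nat).

Definition strictly_above (w v : address) : bool := prefix v w && (v != w).

Definition graft_addresses (s : seq (seq address)) : seq address :=
  [seq i :: a | i <- iota 0 (size s), a <- nth [::] s i].

Section Trees.
Variable L : Type.

(* The leaves are listed from left to right.                                  *)
Fixpoint leaves (t : tree L) : seq address :=
  match t with
  | Leaf => [:: [::]]
  | Node _ ts => graft_addresses (map leaves ts)
  end.

Fixpoint nodes (t : tree L) : seq address :=
  match t with
  | Leaf => [::]
  | Node _ ts => [::] :: graft_addresses (map nodes ts)
  end.

Fixpoint label_at (t : tree L) (a : address) : option L :=
  match t, a with
  | Leaf, _ => None
  | Node l _, [::] => Some l
  | Node _ ts, i :: b => label_at (nth Leaf ts i) b
  end.

Fixpoint plane_tree (t : tree L) : bool :=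
  match t with
  | Leaf => true
  | Node _ ts => (2 <= size ts) && all plane_tree ts
  end.

(* A weak order on the nodes v of t such that lev v is not None, given as an  *)
(* ordered partition: the levels are numbered consecutively from 0 (so that a *)
(* weak order has exactly one encoding) and lev v is the number of the level  *)
(* containing v.                                                              *)
Definition levels (t : tree L) (lev : address -> option nat) : seq nat :=
  undup (pmap lev (nodes t)).

Definition weak_order (t : tree L) (lev : address -> option nat) : bool :=
  perm_eq (levels t lev) (iota 0 (size (levels t lev))) &&
  all2rel (fun v w => strictly_above w v ==>
             if (lev v, lev w) is (Some j, Some k) then j < k else true)
          (nodes t).

End Trees.

(* Painted and unpainted nodes may carry a level: A = nat (resp. B = nat) for *)
(* trees with a weak order on the painted (resp. unpainted) nodes, and unit   *)
(* where there is no such order.                                              *)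
Inductive label (A B : Type) : Type :=
| Painted : A -> label A B
| Half : label A B
| Unpainted : B -> label A B.
Arguments Painted {A B}.
Arguments Half {A B}.
Arguments Unpainted {A B}.

Section Painted.
Variables A B : Type.
Implicit Type t : tree (label A B).

Definition painted_at t (v : address) : bool :=
  if label_at t v is Some (Painted _) then true else false.

Definition half_at t (v : address) : bool :=
  if label_at t v is Some Half then true else false.

Definition unpainted_at t (v : address) : bool :=
  if label_at t v is Some (Unpainted _) then true else false.

Definition painted_tree t : bool :=
  plane_tree t &&
  all2rel (fun v w => strictly_above w v ==>
             (half_at t v || unpainted_at t v) ==> unpainted_at t w)
          (nodes t).

End Painted.

Definition painted_level (B : Type) (t : tree (label nat B)) (v : address) :
  option nat := if label_at t v is Some (Painted k) then Some k else None.

Definition unpainted_level (A : Type) (t : tree (label A nat)) (v : address) :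
  option nat := if label_at t v is Some (Unpainted k) then Some k else None.

Definition W_pred (n : nat) (t : tree (label nat nat)) : bool :=
  [&& painted_tree t, size (leaves t) == n.+1,
      weak_order t (painted_level t) & weak_order t (unpainted_level t)].

Definition W (n : nat) := {t : tree (label nat nat) | W_pred n t}.

Definition X_pred (n : nat) (t : tree (label nat unit)) : bool :=
  [&& painted_tree t, size (leaves t) == n.+1,
      weak_order t (painted_level t)
    & all2rel (fun v w => ~~ [&& strictly_above w v, unpainted_at t v
                               & unpainted_at t w]) (nodes t)].

Definition X (n : nat) := {t : tree (label nat unit) | X_pred n t}.

(* The inputs that t contributes to an unpainted node it is attached to, once *)
(* the edge below t is contracted if the root of t is also unpainted.         *)
Definition contract_edge (t : tree (label nat unit)) :
  seq (tree (label nat unit)) :=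
  if t is Node (Unpainted _) ts then ts else [:: t].

Fixpoint forget (t : tree (label nat nat)) : tree (label nat unit) :=
  match t with
  | Leaf => Leaf
  | Node (Painted k) ts => Node (Painted k) (map forget ts)
  | Node Half ts => Node Half (map forget ts)
  | Node (Unpainted _) ts =>
      Node (Unpainted tt) (flatten (map contract_edge (map forget ts)))
  end.

(* The first common node of the paths from a and b to the root: the longest   *)
(* common prefix.                                                             *)
Fixpoint meet (a b : address) : address :=
  match a, b with
  | i :: a', j :: b' => if i == j then i :: meet a' b' else [::]
  | _, _ => [::]
  end.

Definition gap_end (L : Type) (t : tree L) (i : nat) : address :=
  meet (nth [::] (leaves t) i.-1) (nth [::] (leaves t) i).

Definition pi (n : nat) (t : tree (label nat nat)) : seq {set 'I_n.+1} :=
  [seq [set i : 'I_n.+1 | (0 < i) && (painted_level t (gap_end t i) == Some k)]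
     | k <- iota 0 (size (levels t (painted_level t)))]
  ++ [set i : 'I_n.+1 | (i == ord0) || half_at t (gap_end t i)]
  :: [seq [set i : 'I_n.+1 |
             (0 < i) && (unpainted_level t (gap_end t i) == Some k)]
        | k <- iota 0 (size (levels t (unpainted_level t)))].

Definition ordered_partition (T : finType) (s : seq {set T}) (A : {set T}) :
  bool := uniq s && partition [set:: s] A.

Definition refines (T : finType) (P Q : seq {set T}) : Prop :=
  exists2 ss : seq (seq {set T}),
    all2 (@ordered_partition T) ss Q & P = flatten ss.

Definition growth_step (n : nat) (x y : X n) : Prop :=
  exists t s : W n,
    [/\ forget (val t) = val x, forget (val s) = val y
      & refines (pi n (val s)) (pi n (val t))].

Definition growth_le (n : nat) (y x : X n) : Prop :=
  clos_refl_trans (X n) (@growth_step n) x y.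

(* Main.v *)
From HB Require Import structures.
From Stdlib Require Import Relations.
From mathcomp Require Import all_boot.
Require Import Defs.

Set Implicit Arguments.
Unset Strict Implicit.
Unset Printing Implicit Defensive.

(** Read from left to right, the labels of the nodes at which the gaps of a
    tree end form a word. With the order [Painted k < Half < Unpainted k'], the
    trees of [X n] and [W n] are exactly the plane trees whose labels strictly
    increase away from the root, and such a tree is determined by its word,
    which can be any word with the right set of levels. So an element of [X n]
    is a weak order on [{0, ..., n}] in which 0, labelled [Half], has at most
    one block above its own.
    Refinement of painted growth orders is implication of the strict relations
    [label i < label j], and the tubing corresponding to a tree consists of the
    up-sets containing 0 of its weak order (they form a chain) and the
    singletons of the unpainted gaps. A growth step from [x] to [y] therefore
    exists exactly when the tubing of [x] is contained in that of [y]. *)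

(** * Trees and their words *)

Section TreeInduction.
Variables (L : Type) (P : tree L -> Prop).
Hypothesis PLeaf : P Leaf.
Hypothesis PNode : forall l ts, (forall i, P (nth Leaf ts i)) -> P (Node l ts).

(** Inputs are indexed by position, with [Leaf] past the end, which matches the way [label_at]
    follows an address. *)
Lemma tree_nth_ind : forall t, P t.
Proof.
fix IH 1 => -[|l ts]; first exact: PLeaf.
apply: PNode; elim: ts => [|t ts IHts] [|i]; [exact: PLeaf..| |exact: IHts].
exact: IH.
Qed.
End TreeInduction.

Section LabelEq.
Variables A B : eqType.

Definition label_code (l : label A B) : A + option B :=
  match l with
  | Painted a => inl a
  | Half => inr None
  | Unpainted b => inr (Some b)
  end.

Definition label_decode (c : A + option B) : label A B :=
  match c with
  | inl a => Painted a
  | inr None => Half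
  | inr (Some b) => Unpainted b
  end.

Lemma label_codeK : cancel label_code label_decode.
Proof. by case. Qed.

HB.instance Definition _ := Equality.copy (label A B) (can_type label_codeK).
End LabelEq.

(** Readdresses a forest after one more tree is put in front of it. *)
Definition shift (a : seq nat) : seq nat := if a is i :: b then i.+1 :: b else a.

Lemma graft_addresses_cons s ss :
  graft_addresses (s :: ss) = map (cons 0) s ++ map shift (graft_addresses ss).
Proof.
rewrite /graft_addresses /= -[1]addn0 iotaDl allpairs_mapl map_allpairs /=.
by congr (_ ++ _); apply/esym/map_id_in.
Qed.

Lemma mem_graft_addresses ss i (a : seq nat) :
  (i :: a \in graft_addresses ss) = (i < size ss) && (a \in nth [::] ss i).
Proof.
apply/allpairsPdep/andP => [[j [b [+ jb [-> ->]]]]|[iss ia]].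
  by rewrite mem_iota.
by exists i, a; rewrite mem_iota.
Qed.

Lemma nil_graft_addresses ss : [::] \notin graft_addresses ss.
Proof. by apply/negP => /allpairsPdep[j [b []]]. Qed.

Lemma label_at_shift (L : Type) (l : L) t ts a :
  label_at (Node l (t :: ts)) (shift a) = label_at (Node l ts) a.
Proof. by case: a. Qed.

Lemma strictly_above_cons i (v w : seq nat) :
  strictly_above (i :: w) (i :: v) = strictly_above w v.
Proof. by rewrite /strictly_above /= eqxx eqseq_cons eqxx. Qed.

Section Words.
Variable L : eqType.
Implicit Types (t : tree L) (ts : seq (tree L)) (l : L) (R : rel L).

Fixpoint node_labels t : seq L :=
  if t is Node l ts then l :: flatten (map node_labels ts) else [::].

(* The labels of the nodes at which the successive gaps end. *)
Fixpoint word t : seq L :=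
  if t is Node l ts then behead (flatten (map (fun s => l :: word s) ts))
  else [::].

(** A node is compared with all nodes above it, not only with the nearest ones, because [R] need not
    be transitive: the relation expressing a weak order on part of the nodes is not. *)
Fixpoint ordered R t : bool :=
  if t is Node l ts then
    all (fun s => all (R l) (node_labels s)) ts && all (ordered R) ts
  else true.

Lemma pmap_label_at t : pmap (label_at t) (nodes t) = node_labels t.
Proof.
elim/tree_nth_ind: t => [|l ts IH] /=; [by []|congr (_ :: _)].
elim: ts IH => [//|t ts IHts] IH /=.
rewrite graft_addresses_cons pmap_cat -(IH 0) -IHts; last by move=> i; apply: (IH i.+1).
congr (_ ++ _); first by elim: (nodes t) => //= a s <-.
by elim: (graft_addresses _) => //= -[|i a] s /= <-.
Qed.

Lemma node_label_at t v : v \in nodes t -> exists l, label_at t v = Some l.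
Proof.
elim/tree_nth_ind: t v => [//|l ts IH] [|i v] /=; first by exists l.
rewrite inE mem_graft_addresses size_map => /andP[lti].
by rewrite (nth_map Leaf) //; apply: IH.
Qed.

Lemma mem_node_labels t l :
  reflect (exists2 v, v \in nodes t & label_at t v = Some l)
          (l \in node_labels t).
Proof.
rewrite -pmap_label_at mem_pmap.
by apply: (iffP mapP) => -[v vt e]; exists v.
Qed.

Lemma mem_nodes_cons l ts i v :
  (i :: v \in nodes (Node l ts)) =
  (i < size ts) && (v \in nodes (nth Leaf ts i)).
Proof.
rewrite inE mem_graft_addresses size_map.
by case: ltnP => //= lti; rewrite (nth_map Leaf).
Qed.

Lemma ordered_iff R t :
  ordered R t <->
  (forall v w a b, v \in nodes t -> w \in nodes t -> strictly_above w v ->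
     label_at t v = Some a -> label_at t w = Some b -> R a b).
Proof.
elim/tree_nth_ind: t => [|l ts IH]; first by split.
split=> [/andP[/(all_nthP Leaf) Rl /(all_nthP Leaf) Rts]|H].
  move=> [|i v] [|j w] a b //.
    rewrite mem_nodes_cons /= => _ /andP[ltj wj] _ [<-] wb.
    by apply: (allP (Rl _ ltj)); apply/mem_node_labels; exists w.
  have [->|neq] := eqVneq i j; last by rewrite /strictly_above /= (negPf neq).
  rewrite !mem_nodes_cons strictly_above_cons => /andP[ltj vj] /andP[_ wj] /= vw va wb.
  have Rij : ordered R (nth Leaf ts j) by exact: Rts.
  by apply: (iffLR (IH j) Rij v w a b).
apply/andP; split; apply/(all_nthP Leaf) => i lti.
  apply/allP => b /mem_node_labels[w wi wb].
  by apply: (H [::] (i :: w)) => //; rewrite mem_nodes_cons lti.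
apply/IH => v w a b vi wi vw va wb.
by apply: (H (i :: v) (i :: w)); rewrite ?mem_nodes_cons ?lti ?strictly_above_cons.
Qed.

Lemma orderedP R t :
  reflect (forall v w a b, v \in nodes t -> w \in nodes t ->
             strictly_above w v -> label_at t v = Some a ->
             label_at t w = Some b -> R a b)
          (ordered R t).
Proof. by apply: (iffP idP) => /ordered_iff. Qed.

(** Every node has at least two inputs, so at least one gap ends at it. *)
Lemma mem_word t : plane_tree t -> word t =i node_labels t.
Proof.
elim/tree_nth_ind: t => [//|l ts IH] /= /andP[size_ts plane_ts] x.
have Wts : (x == l) || (x \in flatten [seq l :: word s | s <- ts]) =
           (x == l) || (x \in flatten (map node_labels ts)).
  elim: ts IH plane_ts {size_ts} => [//|t ts IHts] IH /= /andP[plane_t plane_ts].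
  have := IHts (fun i => IH i.+1) plane_ts.
  by rewrite inE !mem_cat (IH 0) //; case: (x == l) => //= ->.
(* A second input contributes another [l], so dropping the first letter loses no label. *)
rewrite inE -Wts; case: ts size_ts {IH Wts plane_ts} => [//|t [//|t' ts]] _ /=.
by rewrite inE !mem_cat inE; case: (x == l); rewrite ?orbT.
Qed.

(** * Gaps between leaves *)

Definition gap_ends (s : seq (seq nat)) : seq (seq nat) :=
  if s is a :: s' then pairmap meet a s' else [::].

Lemma meet_shift a b : meet (shift a) (shift b) = shift (meet a b).
Proof. by case: a b => [|i a] [|j b] //=; rewrite eqSS; case: eqP. Qed.

Lemma gap_ends_map f s : (forall a b, meet (f a) (f b) = f (meet a b)) ->
  gap_ends (map f s) = map f (gap_ends s).
Proof.
by move=> fM; case: s => //= a s; elim: s a => //= b s IHs a; rewrite fM IHs.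
Qed.

Lemma gap_ends_cat a s b s' :
  gap_ends ((a :: s) ++ b :: s') =
  gap_ends (a :: s) ++ meet (last a s) b :: gap_ends (b :: s').
Proof. by rewrite /= pairmap_cat. Qed.

Lemma leaves_gt0 t : plane_tree t -> 0 < size (leaves t).
Proof.
elim/tree_nth_ind: t => [//|l [//|t ts] IH] /= /andP[_ /andP[/(IH 0)]].
by rewrite graft_addresses_cons size_cat size_map /=; case: size.
Qed.

(** Gaps inside an input end inside it, and the gap between two successive inputs ends at the root;
    this is the [l] between the words of the inputs. *)
Lemma label_gap_ends t : plane_tree t ->
  map (label_at t) (gap_ends (leaves t)) = map Some (word t).
Proof.
elim/tree_nth_ind: t => [//|l ts IH] /= /andP[_].
elim: ts IH => [//|t ts IHts] IH /= /andP[plane_t plane_ts].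
have {IHts} := IHts (fun i => IH i.+1) plane_ts.
rewrite graft_addresses_cons => {}IHts.
have lt_t : [seq label_at (Node l (t :: ts)) a
            | a <- gap_ends (map (cons 0) (leaves t))] = map Some (word t).
  rewrite gap_ends_map; last by [].
  by rewrite -map_comp -(IH 0).
have lt_ts : [seq label_at (Node l (t :: ts)) a
            | a <- gap_ends (map shift (graft_addresses (map (@leaves L) ts)))] =
            [seq label_at (Node l ts) a | a <- gap_ends (graft_addresses (map (@leaves L) ts))].
  rewrite gap_ends_map; last exact: meet_shift.
  by rewrite -map_comp; apply: eq_map => a; apply: label_at_shift.
case: ts IH plane_ts IHts lt_t lt_ts => [|t' ts] IH plane_ts IHts lt_t lt_ts.
  by rewrite /= !cats0.
rewrite [RHS](_ : _ = map Some (word t ++ l :: behead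
  (flatten [seq l :: word s | s <- t' :: ts]))) //.
rewrite map_cat [map Some (l :: _)]map_cons -lt_t -[in RHS]IHts -lt_ts.
have := leaves_gt0 plane_t.
case: (leaves t) => [//|a s] _.
have : 0 < size (graft_addresses (map (@leaves L) (t' :: ts))).
  case/andP: plane_ts => /leaves_gt0; rewrite /= graft_addresses_cons size_cat size_map.
  by case: size.
have := nil_graft_addresses (map (@leaves L) (t' :: ts)).
(* Addresses in the later inputs start with a positive position after [shift], so they meet those
   starting with 0 at the root. *)
case: (graft_addresses _) => [//|[//|i b] s'] _ _.
rewrite [map shift _]/= [map (cons 0) _]/= gap_ends_cat map_cat; congr (_ ++ _).
rewrite map_cons; congr (_ :: _).
by rewrite (last_map (cons 0)).
Qed.

Lemma size_word t : plane_tree t -> size (leaves t) = (size (word t)).+1.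
Proof.
move=> plane_t; have := congr1 size (label_gap_ends plane_t); rewrite !size_map => <-.
by have := leaves_gt0 plane_t; case: (leaves t) => //= a s _; rewrite size_pairmap.
Qed.

Lemma label_gap_end t i l : plane_tree t -> 0 < i <= size (word t) ->
  label_at t (gap_end t i) = Some (nth l (word t) i.-1).
Proof.
move=> plane_t; case: i => // i /= lti.
rewrite -(nth_map l (Some l)) // -label_gap_ends //.
have /eqP := size_word plane_t; rewrite /gap_end.
case: (leaves t) => //= a s; rewrite eqSS => /eqP size_s.
rewrite (nth_map [::]) ?size_pairmap ?size_s //.
by rewrite (nth_pairmap [::]) ?size_s.
Qed.
End Words.

Definition increasing (L : eqType) (lt : rel L) (t : tree L) : bool :=
  plane_tree t && ordered lt t.

(** * Reconstruction of an increasing tree from its word *)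

Section Build.
Variables (L : eqType) (lt : rel L).
Hypothesis lt_irr : irreflexive lt.
Hypothesis lt_trans : transitive lt.
Hypothesis lt_total : forall x y, x != y -> lt x y || lt y x.
Implicit Types (t : tree L) (ts : seq (tree L)) (l : L) (w : seq L).

(* Attaches a leaf on the left of t so that the new first gap is labelled l. *)
Fixpoint add_leaf l t : tree L :=
  match t with
  | Leaf => Node l [:: Leaf; Leaf]
  | Node l' ts =>
      if lt l l' then Node l [:: Leaf; t]
      else if l == l' then Node l (Leaf :: ts)
      else if ts is t0 :: ts' then Node l' (add_leaf l t0 :: ts') else t
  end.

Definition build w : tree L := foldr add_leaf Leaf w.

Lemma lt_asym x y : lt x y -> lt y x = false.
Proof. by move=> xy; apply/negP => /(lt_trans xy); rewrite lt_irr. Qed.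

Lemma word_add_leaf l t : plane_tree t -> word (add_leaf l t) = l :: word t.
Proof.
elim/tree_nth_ind: t => [//|l' [//|t ts] IH] /andP[_ /andP[plane_t _]].
rewrite [add_leaf _ _]/=; case: ifP => _; first by rewrite /= cats0.
case: ifP => [/eqP ->|_] //=.
by have /= -> := IH 0 plane_t.
Qed.

Lemma node_labels_add_leaf l t : plane_tree t ->
  node_labels (add_leaf l t) =i l :: node_labels t.
Proof.
elim/tree_nth_ind: t => [//|l' [//|t ts] IH] /andP[_ /andP[plane_t _]] x.
rewrite [add_leaf _ _]/=; case: ifP => _; first by rewrite /= cats0.
case: ifP => [/eqP ->|_] /=; first by rewrite !inE orbA orbb.
have /= IH0 := IH 0 plane_t x; rewrite !inE !mem_cat IH0 inE.
by rewrite -!orbA orbCA.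
Qed.

(** Along the leftmost branch, [l] joins an equal label, or enters just below the first larger
    label, or at the end of the branch if all labels are smaller. *)
Lemma increasing_add_leaf l t : increasing lt t -> increasing lt (add_leaf l t).
Proof.
rewrite /increasing; elim/tree_nth_ind: t => [//|l' [//|t ts] IH].
case/andP=> plane_n ord_n; have /= /andP[size_ts /andP[plane_t plane_ts]] := plane_n.
have /= /andP[/andP[above_t above_ts] /andP[ord_t ord_ts]] := ord_n.
rewrite [add_leaf _ _]/=; case: ifP => [ll'|not_ll'].
  rewrite /= size_ts plane_t plane_ts ord_t ord_ts above_t above_ts ll' !andbT /=.
  have trans s : all (lt l') s -> all (lt l) s.
    by move/allP => H; apply/allP => x /H; apply: lt_trans.
  rewrite all_cat trans //=; elim: ts above_ts {IH plane_n ord_n size_ts plane_ts ord_ts}.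
    by [].
  by move=> s ts IHts /andP[/trans above_s above_ts]; rewrite /= all_cat above_s IHts.
case: ifP => [/eqP ->|neq] /=.
  by rewrite plane_t plane_ts ord_t ord_ts above_t above_ts.
have := IH 0; rewrite /= plane_t ord_t => /(_ isT) /andP[-> ->].
rewrite size_ts plane_ts ord_ts above_ts !andbT /=.
(* The first input gains only the label [l], and totality places [l] above [l']. *)
apply/allP => x; rewrite node_labels_add_leaf // inE => /predU1P[->|/(allP above_t) //].
by have := lt_total (negbT neq); rewrite not_ll'.
Qed.

Lemma increasing_build w : increasing lt (build w).
Proof. by elim: w => //= l w; apply: increasing_add_leaf. Qed.

Lemma buildK w : word (build w) = w.
Proof.
elim: w => //= l w IHw; rewrite word_add_leaf ?IHw //.
by case/andP: (increasing_build w).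
Qed.

(** Read from the right, the letters of the last input rebuild it, the next [l] puts a leaf before
    it under a root labelled [l], and the letters of the preceding input, all above [l], act on that
    leaf alone. *)
Lemma wordK t : increasing lt t -> build (word t) = t.
Proof.
rewrite /increasing; elim/tree_nth_ind: t => [//|l ts IH].
case/andP=> /= /andP[size_ts plane_ts] /andP[above_ts ord_ts].
have add_above t0 ts' w : all (lt l) w ->
    foldr add_leaf (Node l (t0 :: ts')) w = Node l (foldr add_leaf t0 w :: ts').
  elim: w => //= a w IHw /andP[la lw]; rewrite IHw //= lt_asym //.
  by case: eqP la => [->|//]; rewrite lt_irr.
have add_l t : all (lt l) (node_labels t) -> add_leaf l t = Node l [:: Leaf; t].
  by case: t => //= l' ts' /andP[->].
(* The induction on [ts] passes through lists too short to form a plane node; these get values of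
   their own. *)
suff: build (behead (flatten [seq l :: word s | s <- ts])) =
      if ts is [:: t] then t else if ts is [::] then Leaf else Node l ts.
  by move->; case: ts size_ts {IH plane_ts above_ts ord_ts} => [|? []].
elim: ts IH plane_ts above_ts ord_ts {size_ts} => [//|t ts IHts] IH /=.
case/andP=> plane_t plane_ts /andP[above_t above_ts] /andP[ord_t ord_ts].
have := IH 0; rewrite /= plane_t ord_t => /(_ isT) build_t.
have {IHts} := IHts (fun i => IH i.+1) plane_ts above_ts ord_ts.
case: ts IH plane_ts above_ts ord_ts => [|t' ts] IH plane_ts above_ts ord_ts IHts.
  by rewrite /= cats0.
rewrite [flatten _]/= /build foldr_cat /= -/(build (word t' ++ _)).
have -> : build (word t' ++ flatten [seq l :: word s | s <- ts]) =
          if ts is [::] then t' else Node l (t' :: ts).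
  by move: IHts => /= ->; case: (ts).
have above_w : all (lt l) (word t).
  by apply/allP => x; rewrite mem_word // => /(allP above_t).
have -> : add_leaf l (if ts is [::] then t' else Node l (t' :: ts)) =
          Node l [:: Leaf, t' & ts].
  case: (ts) => [|? ?]; first by rewrite add_l //; case/andP: above_ts.
  by rewrite /= lt_irr eqxx.
by rewrite add_above // -/(build _) build_t.
Qed.
End Build.

(** * Characterization of the painted trees by their labels *)

Section LabelOrder.
Variables (B : eqType) (c : rel B).

(** [c] compares unpainted labels: [ltn] for [W n], the empty relation on [unit] for [X n]. The
    latter forbids an unpainted node above another and is still total on distinct labels. *)
Definition label_lt : rel (label nat B) := fun x y =>
  match x, y with
  | Painted j, Painted k => j < k
  | Painted _, _ | Half, Unpainted _ => true
  | Unpainted a, Unpainted b => c a b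
  | _, _ => false
  end.

Lemma label_lt_irr : irreflexive c -> irreflexive label_lt.
Proof. by move=> c_irr [k||b] //=; apply: ltnn. Qed.

Lemma label_lt_trans : transitive c -> transitive label_lt.
Proof.
by move=> c_trans [j||a] [k||b] [m||d] //=; [apply: ltn_trans | apply: c_trans].
Qed.

Lemma label_lt_total : (forall a b, a != b -> c a b || c b a) ->
  forall x y, x != y -> label_lt x y || label_lt y x.
Proof.
move=> c_total [j||a] [k||b] //= neq; first by rewrite -neq_ltn.
by apply: c_total; apply: contra_neq neq => ->.
Qed.
End LabelOrder.

Notation ltW := (label_lt ltn).
Notation ltX := (label_lt (fun _ _ : unit => false)).

Definition ltW_irr := label_lt_irr (c := ltn) ltnn.
Definition ltW_trans := label_lt_trans (c := ltn) ltn_trans.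

Lemma ltW_total x y : x != y -> ltW x y || ltW y x.
Proof. by apply: label_lt_total => a b; rewrite neq_ltn. Qed.

Lemma ltX_irr : irreflexive ltX.
Proof. exact: label_lt_irr. Qed.

Lemma ltX_trans : transitive ltX.
Proof. exact: label_lt_trans. Qed.

Lemma ltX_total x y : x != y -> ltX x y || ltX y x.
Proof. by apply: label_lt_total => -[] []. Qed.

Definition painted_rank B (l : label nat B) : option nat :=
  if l is Painted k then Some k else None.

Definition unpainted_rank A (l : label A nat) : option nat :=
  if l is Unpainted k then Some k else None.

Definition normal_levels (s : seq nat) : bool :=
  perm_eq (undup s) (iota 0 (size (undup s))).

Lemma mem_normal_levels s k :
  normal_levels s -> (k \in s) = (k < size (undup s)).
Proof. by move=> /perm_mem/(_ k); rewrite mem_undup mem_iota. Qed.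

Lemma normal_levels_initial s m : (forall k, (k \in s) = (k < m)) -> normal_levels s.
Proof.
move=> sm; have p : perm_eq (undup s) (iota 0 m).
  by apply: uniq_perm (undup_uniq _) (iota_uniq _ _) _ => k; rewrite mem_undup sm mem_iota.
by rewrite /normal_levels (perm_size p) size_iota.
Qed.

Lemma pmap_obind (T U V : Type) (f : T -> option U) (g : U -> option V) (s : seq T) :
  pmap (fun x => obind g (f x)) s = pmap g (pmap f s).
Proof. by elim: s => //= x s ->; case: (f x) => //= u; case: (g u). Qed.

Lemma levels_word (L : eqType) (t : tree L) (rk : L -> option nat) lev :
  plane_tree t -> (forall v, lev v = obind rk (label_at t v)) ->
  perm_eq (levels t lev) (undup (pmap rk (word t))).
Proof.
move=> plane_t levE; apply: perm_undup => k; rewrite (eq_pmap levE) pmap_obind.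
by rewrite pmap_label_at !mem_pmap; apply: eq_mem_map => l; rewrite mem_word.
Qed.

(** Every node label occurs in the word, so the set of levels can be read off the word. *)
Lemma weak_orderE (L : eqType) (t : tree L) (rk : L -> option nat) lev :
  plane_tree t -> (forall v, lev v = obind rk (label_at t v)) ->
  weak_order t lev <-> normal_levels (pmap rk (word t)) /\
   ordered (fun a b => if (rk a, rk b) is (Some j, Some k) then j < k else true) t.
Proof.
move=> plane_t levE; have lev_t := levels_word plane_t levE.
rewrite /weak_order (perm_size lev_t) (permPl lev_t) -/(normal_levels _).
split=> [/andP[-> /allrelP H]|[-> /orderedP H]]; last first.
  apply/allrelP => v w vt wt; apply/implyP => vw; rewrite !levE.
  have [a va] := node_label_at vt; have [b wb] := node_label_at wt.
  by rewrite va wb; apply: H vt wt vw va wb.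
split=> //; apply/orderedP => v w a b vt wt vw va wb.
by have /implyP/(_ vw) := H v w vt wt; rewrite !levE va wb.
Qed.

Lemma painted_levelE B (t : tree (label nat B)) v :
  painted_level t v = obind (@painted_rank B) (label_at t v).
Proof. by []. Qed.

Lemma unpainted_levelE A (t : tree (label A nat)) v :
  unpainted_level t v = obind (@unpainted_rank A) (label_at t v).
Proof. by []. Qed.

Lemma painted_treeE (A B : eqType) (t : tree (label A B)) :
  painted_tree t <-> plane_tree t /\
  ordered (fun a b => if a is Painted _ then true
                      else if b is Unpainted _ then true else false) t.
Proof.
split=> [/andP[-> /allrelP H]|[plane_t /orderedP H]].
  split=> //; apply/orderedP => v w a b vt wt vw va wb.
  have /implyP/(_ vw) := H v w vt wt; rewrite /half_at /unpainted_at va wb.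
  by case: a {va}.
apply/andP; split=> //; apply/allrelP => v w vt wt; apply/implyP => vw.
have [a va] := node_label_at vt; have [b wb] := node_label_at wt.
rewrite /half_at /unpainted_at va wb; have := H _ _ _ _ vt wt vw va wb.
by case: a {va}.
Qed.

(** For each pair of labels, the painting condition and the two weak orders hold together exactly
    when [ltW] does. *)
Lemma W_predE n t :
  W_pred n t = [&& increasing ltW t, size (word t) == n,
                   normal_levels (pmap (@painted_rank _) (word t))
                 & normal_levels (pmap (@unpainted_rank _) (word t))].
Proof.
have [plane_t|/negPf not_plane] := boolP (plane_tree t); last first.
  by rewrite /W_pred /painted_tree /increasing not_plane.
rewrite /W_pred size_word // eqSS; apply/and4P/and4P.
  case=> /painted_treeE[_ /orderedP H1] ->.
  move=> /(weak_orderE plane_t (painted_levelE t)) [-> /orderedP H2].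
  move=> /(weak_orderE plane_t (unpainted_levelE t)) [-> /orderedP H3].
  split=> //; apply/andP; split=> //; apply/orderedP => v w a b vt wt vw va wb.
  have := H1 _ _ _ _ vt wt vw va wb; have := H2 _ _ _ _ vt wt vw va wb.
  by have := H3 _ _ _ _ vt wt vw va wb; case: a {va}; case: b {wb}.
case=> /andP[_ /orderedP H] -> nP nU; split=> //.
- apply/painted_treeE; split=> //; apply/orderedP => v w a b vt wt vw va wb.
  by have := H _ _ _ _ vt wt vw va wb; case: a {va}; case: b {wb}.
- apply/(weak_orderE plane_t (painted_levelE t)); split=> //.
  apply/orderedP => v w a b vt wt vw va wb.
  by have := H _ _ _ _ vt wt vw va wb; case: a {va}; case: b {wb}.
- apply/(weak_orderE plane_t (unpainted_levelE t)); split=> //.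
  apply/orderedP => v w a b vt wt vw va wb.
  by have := H _ _ _ _ vt wt vw va wb; case: a {va}; case: b {wb}.
Qed.

Lemma X_predE n t :
  X_pred n t = [&& increasing ltX t, size (word t) == n
                 & normal_levels (pmap (@painted_rank _) (word t))].
Proof.
have [plane_t|/negPf not_plane] := boolP (plane_tree t); last first.
  by rewrite /X_pred /painted_tree /increasing not_plane.
rewrite /X_pred size_word // eqSS; apply/and4P/and3P.
  case=> /painted_treeE[_ /orderedP H1] ->.
  move=> /(weak_orderE plane_t (painted_levelE t)) [-> /orderedP H2] /allrelP H3.
  split=> //; apply/andP; split=> //; apply/orderedP => v w a b vt wt vw va wb.
  have := H1 _ _ _ _ vt wt vw va wb; have := H2 _ _ _ _ vt wt vw va wb.
  have := H3 _ _ vt wt; rewrite vw /unpainted_at va wb.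
  by case: a {va}; case: b {wb}.
case=> /andP[_ /orderedP H] -> nP; split=> //.
- apply/painted_treeE; split=> //; apply/orderedP => v w a b vt wt vw va wb.
  by have := H _ _ _ _ vt wt vw va wb; case: a {va}; case: b {wb}.
- apply/(weak_orderE plane_t (painted_levelE t)); split=> //.
  apply/orderedP => v w a b vt wt vw va wb.
  by have := H _ _ _ _ vt wt vw va wb; case: a {va}; case: b {wb}.
- apply/allrelP => v w vt wt; apply/negP => /and3P[vw].
  have [a va] := node_label_at vt; have [b wb] := node_label_at wt.
  rewrite /unpainted_at va wb; have := H _ _ _ _ vt wt vw va wb.
  by case: a {va}; case: b {wb}.
Qed.

(** * The forgetful map on words *)

Definition forget_level (l : label nat nat) : label nat unit :=
  match l with
  | Painted k => Painted k
  | Half => Half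
  | Unpainted _ => Unpainted tt
  end.

Lemma forget_NodeE l ts :
  forget (Node l ts) = Node (forget_level l)
    (if l is Unpainted _ then flatten (map contract_edge (map forget ts))
     else map forget ts).
Proof. by case: l. Qed.

(** [word u] omits the root letter before its first input. The letter of the gap preceding [u] takes
    that place, so contraction leaves the sequence of letters unchanged. *)
Lemma contract_edge_cat_word u : plane_tree u ->
  flatten [seq Unpainted tt :: word s | s <- contract_edge u] =
  Unpainted tt :: word u.
Proof.
case: u => [//|[k||[]] ts] /= /andP[size_ts _]; rewrite ?cats0 //.
by case: ts size_ts.
Qed.

(** A contraction replaces an input by at least two, so the node below keeps enough inputs. *)
Lemma plane_contract_edges us : all (@plane_tree _) us ->
  (size us <= size (flatten (map contract_edge us))) &&
  all (@plane_tree _) (flatten (map contract_edge us)).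
Proof.
elim: us => //= u us IHus /andP[plane_u /IHus/andP[size_us plane_us]].
rewrite size_cat all_cat plane_us andbT.
have /andP[size_u ->] : (0 < size (contract_edge u)) && all (@plane_tree _) (contract_edge u).
  by case: u plane_u => [|[k||[]] us'] //= /andP[size_us' ->];
    rewrite ?size_us' ?(ltnW size_us').
by rewrite andbT -add1n leq_add.
Qed.

Lemma plane_forget t : plane_tree t -> plane_tree (forget t).
Proof.
elim/tree_nth_ind: t => [//|l ts IH] /= /andP[size_ts plane_ts].
have plane_fts : all (@plane_tree _) (map forget ts).
  rewrite all_map; apply/(all_nthP Leaf) => i lti; apply: IH.
  exact: (all_nthP Leaf plane_ts).
have /andP[size_us plane_us] := plane_contract_edges plane_fts.
rewrite size_map in size_us.
by case: l => [k||k] /=; rewrite ?size_map ?size_ts ?(leq_trans size_ts size_us).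
Qed.

Lemma word_forget t : plane_tree t -> word (forget t) = map forget_level (word t).
Proof.
elim/tree_nth_ind: t => [//|l ts IH]; rewrite forget_NodeE /= => /andP[_ plane_ts].
have wts : flatten [seq forget_level l :: word s | s <- map forget ts] =
           map forget_level (flatten [seq l :: word s | s <- ts]).
  elim: ts IH plane_ts => [//|t ts IHts] IH /= /andP[plane_t plane_ts].
  by rewrite map_cat (IHts (fun i => IH i.+1)) // (IH 0).
rewrite -behead_map -wts; congr behead.
case: l {wts} => [k||k] //=.
have plane_fts : all (@plane_tree _) (map forget ts).
  rewrite all_map; apply/(all_nthP Leaf) => i lti; apply: plane_forget.
  exact: (all_nthP Leaf plane_ts).
elim: (map forget ts) plane_fts => //= u us IHus /andP[plane_u plane_us].
by rewrite map_cat flatten_cat contract_edge_cat_word // IHus.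
Qed.

(** Below painted and half-painted labels [ltW] survives the forgetting of levels. Above an
    unpainted node all nodes are unpainted, and the contractions remove them. *)
Lemma increasing_forget t : increasing ltW t -> increasing ltX (forget t).
Proof.
rewrite /increasing => /andP[plane_t ord_t]; rewrite plane_forget //=.
elim/tree_nth_ind: t plane_t ord_t => [//|l ts IH].
rewrite forget_NodeE /= => /andP[_ /(all_nthP Leaf) plane_ts].
case/andP=> /(all_nthP Leaf) above_ts /(all_nthP Leaf) ord_ts.
have ord_fts i : i < size ts -> ordered ltX (forget (nth Leaf ts i)).
  by move=> lti; apply: IH; [apply: plane_ts | apply: ord_ts].
have labels_fts i x : i < size ts -> x \in node_labels (forget (nth Leaf ts i)) ->
    exists2 y, ltW l y & x = forget_level y.
  move=> lti; rewrite -mem_word ?plane_forget ?plane_ts // word_forget ?plane_ts //.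
  case/mapP=> y; rewrite mem_word ?plane_ts // => yi ->; exists y => //.
  exact: (allP (above_ts _ lti)).
case: l {IH above_ts} labels_fts => [k||k] labels_fts.
- rewrite !all_map; apply/andP; split; apply/(all_nthP Leaf) => // i lti.
  by apply/allP => x /labels_fts[] // [j||j] ? ->.
- rewrite !all_map; apply/andP; split; apply/(all_nthP Leaf) => // i lti.
  by apply/allP => x /labels_fts[] // [j||j] ? ->.
(* After contraction the inputs of an unpainted node carry no node: a label there would be
   [Unpainted tt] and also lie [ltX]-above [Unpainted tt]. *)
suff : all (fun u => (node_labels u == [::]) && ordered ltX u)
           (flatten (map contract_edge (map forget ts))).
  by rewrite -all_predI; apply: sub_all => u /= /andP[/eqP -> ->].
have : all (fun u => ordered ltX u && all (pred1 (Unpainted tt)) (node_labels u))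
           (map forget ts).
  rewrite all_map; apply/(all_nthP Leaf) => i lti /=; rewrite ord_fts //=.
  by apply/allP => x /labels_fts[] // [j||j] // ? ->.
elim: (map forget ts) => //= u us IHus /andP[/andP[ord_u unp_u] /IHus].
rewrite all_cat => ->; rewrite andbT.
case: u ord_u unp_u => [|[j||[]] us'] //= /andP[above_us ord_us] unp_us.
elim: us' above_us ord_us unp_us => //= u' us' IHus'.
case/andP=> above_u above_us /andP[-> ord_us].
rewrite all_cat => /andP[unp_u unp_us]; rewrite andbT IHus' // andbT.
case: (node_labels u') above_u unp_u => //= x s /andP[lt_x _] /andP[/eqP x_unp _].
by rewrite x_unp in lt_x.
Qed.

(** * Refinement of ordered partitions *)

Section Refinement.
Variables (T : finType) (L : eqType) (lt : rel L).
Hypothesis lt_irr : irreflexive lt.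
Hypothesis lt_trans : transitive lt.
Hypothesis lt_total : forall x y, x != y -> lt x y || lt y x.

Definition fiber (f : T -> L) (l : L) : {set T} := [set i | f i == l].

Lemma partition_cover (s : seq {set T}) A i :
  ordered_partition s A -> i \in A -> exists2 B, B \in s & i \in B.
Proof.
case/andP=> _ /cover_partition <- /bigcupP[B]; rewrite inE => Bs iB.
by exists B.
Qed.

(** Points of two successive blocks of [Q] lie in blocks of [flatten ss] that come in the same
    order. *)
Lemma refinement_pairwise (r : rel T) (ss : seq (seq {set T})) (Q : seq {set T}) :
  let before := [rel A B : {set T} | [forall i in A, forall j in B, r i j]] in
  all2 (@ordered_partition T) ss Q -> pairwise before (flatten ss) ->
  pairwise before Q.
Proof.
move=> before; elim: ss Q => [|s ss IHss] [|A Q] //= /andP[sA ssQ].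
rewrite pairwise_cat => /and3P[/allrelP s_ss _ /(IHss _ ssQ) ->]; rewrite andbT.
apply/allP => B BQ; apply/forall_inP => i iA; apply/forall_inP => j jB.
have [A' A's iA'] := partition_cover sA iA.
have [B' B'ss jB'] : exists2 B', B' \in flatten ss & j \in B'.
  elim: ss Q ssQ BQ {IHss s_ss} => [|s' ss IHss] [|C Q] //= /andP[s'C ssQ].
  rewrite inE => /predU1P[BC|/(IHss _ ssQ)[B' B'ss jB']].
    rewrite BC in jB; have [B' B's' jB'] := partition_cover s'C jB.
    by exists B'; rewrite // mem_cat B's'.
  by exists B'; rewrite // mem_cat B'ss orbT.
by have /forall_inP/(_ i iA')/forall_inP/(_ j jB') := s_ss _ _ A's B'ss.
Qed.

(** In an increasing list [lt x y] means that [x] comes first, so any pairwise relation applies to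
    the two. *)
Lemma pairwise_lt_nth (s : seq L) (r : rel L) x y :
  pairwise lt s -> pairwise r s -> x \in s -> y \in s -> lt x y -> r x y.
Proof.
elim: s => //= z s IHs /andP[/allP lt_s pw_lt] /andP[/allP r_s pw_r].
rewrite !inE => /predU1P[->|xs] /predU1P[->|ys] xy; last exact: IHs.
- by rewrite lt_irr in xy.
- exact: r_s.
- by have := lt_trans xy (lt_s _ xs); rewrite lt_irr.
Qed.

Variables (f g : T -> L) (ls ms : seq L).
Hypothesis ls_lt : pairwise lt ls.
Hypothesis ms_lt : pairwise lt ms.
Hypothesis f_ls : forall l, l \in ls <-> exists i, f i = l.
Hypothesis g_ms : forall l, l \in ms <-> exists i, g i = l.

(** A refinement keeps the order between points of different blocks. Conversely, if strict
    comparisons are kept, each fiber of [g] is a union of fibers of [f], consecutive in [ls]. *)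
Lemma refines_fibers :
  refines (map (fiber f) ls) (map (fiber g) ms) <->
  (forall i j, lt (g i) (g j) -> lt (f i) (f j)).
Proof.
split=> [[ss ss_ms ls_ss] i j gij|fg].
  have fr : pairwise [rel A B : {set T} | [forall i in A, forall j in B, lt (f i) (f j)]]
                     (map (fiber f) ls).
    rewrite pairwise_map; apply: sub_pairwise ls_lt => l l' ll' /=.
    apply/forall_inP => a; rewrite inE => /eqP ->.
    by apply/forall_inP => b; rewrite inE => /eqP ->.
  rewrite ls_ss in fr; have := refinement_pairwise ss_ms fr.
  rewrite pairwise_map => gr.
  have gi : g i \in ms by apply/g_ms; exists i.
  have gj : g j \in ms by apply/g_ms; exists j.
  have /forall_inP/(_ i) := pairwise_lt_nth ms_lt gr gi gj gij.
  by rewrite inE eqxx => /(_ isT)/forall_inP/(_ j); rewrite inE eqxx; apply.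
(* The block [fiber g m] is to be replaced by the fibers of [f] inside it, in the order of [ls]. *)
pose part m := [seq l <- ls | fiber f l \subset fiber g m].
have part_lt ms' : pairwise lt ms' -> pairwise lt (flatten (map part ms')).
  elim: ms' => //= m ms' IHms /andP[/allP m_ms' /IHms pw].
  rewrite pairwise_cat pw pairwise_filter // !andbT.
  apply/allrelP => l l'; rewrite mem_filter => /andP[/subsetP lm /f_ls[i fi]].
  case/flattenP=> s /mapP[m' m's ->]; rewrite mem_filter => /andP[/subsetP lm' /f_ls[j fj]].
  rewrite -fi -fj; apply: fg.
  have := lm i; rewrite !inE fi eqxx => /(_ isT)/eqP ->.
  have := lm' j; rewrite !inE fj eqxx => /(_ isT)/eqP ->.
  exact: m_ms'.
(* Points with different values of [g] are comparable by totality, hence have different values of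
   [f]. *)
have fiber_sub i : fiber f (f i) \subset fiber g (g i).
  apply/subsetP => j; rewrite !inE => /eqP fji; apply: contraT => /lt_total.
  by case/orP=> /fg; rewrite fji lt_irr.
(* Two increasing lists with the same members are equal. *)
have ls_part : ls = flatten (map part ms).
  apply: (irr_sorted_eq lt_trans lt_irr); rewrite ?sorted_pairwise //; first exact: part_lt.
  move=> l; apply/idP/flattenP => [|[s /mapP[m _ ->]]]; last by rewrite mem_filter => /andP[].
  case/f_ls=> i <-; exists (part (g i)).
    by apply: map_f; apply/g_ms; exists i.
  by rewrite mem_filter fiber_sub; apply/f_ls; exists i.
have ls_uniq : uniq ls by apply: (sorted_uniq lt_trans lt_irr); rewrite sorted_pairwise.
exists (map (map (fiber f)) (map part ms)); last by rewrite -map_flatten -ls_part.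
rewrite -map_comp; have : {subset ms <= ms} by [].
elim: {1 3 4}ms => //= m ms' IHms sub; rewrite IHms ?andbT; last first.
  by move=> m' m'ms; apply: sub; rewrite inE m'ms orbT.
have part_ne A : A \in map (fiber f) (part m) -> A != set0.
  case/mapP=> l; rewrite mem_filter => /andP[_ /f_ls[i <-]] ->.
  by apply/set0Pn; exists i; rewrite inE.
apply/andP; split.
  rewrite map_inj_in_uniq ?filter_uniq // => l l'.
  rewrite mem_filter => /andP[_ /f_ls[i fi]] _ /setP/(_ i).
  by rewrite !inE fi eqxx => /esym/eqP.
apply/and3P; split.
- rewrite eqEsubset; apply/andP; split; apply/subsetP => i.
    case/bigcupP=> A; rewrite inE => /mapP[l]; rewrite mem_filter => /andP[/subsetP lm _] ->.
    exact: lm.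
  rewrite inE => /eqP gi; apply/bigcupP; exists (fiber f (f i)); last by rewrite inE.
  rewrite inE; apply: map_f; rewrite mem_filter -gi fiber_sub.
  by apply/f_ls; exists i.
- apply/trivIsetP => A B; rewrite !inE => /mapP[l _ ->] /mapP[l' _ ->] neq.
  rewrite -setI_eq0; apply: contraNT neq => /set0Pn[i]; rewrite !inE.
  by case/andP=> /eqP -> /eqP ->.
- by rewrite inE; apply/negP => /part_ne; rewrite eqxx.
Qed.
End Refinement.

(** * Painted growth orders in terms of gap labels *)

Section GapLabels.
Variable n : nat.

(* Index 0 is not a gap: as in pi, it goes with the half-painted gaps. *)
Definition gap_label B (w : seq (label nat B)) (i : 'I_n.+1) : label nat B :=
  nth Half (Half :: w) i.

Definition word_of B (F : 'I_n.+1 -> label nat B) : seq (label nat B) :=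
  [seq F (lift ord0 i) | i <- enum 'I_n].

Lemma size_word_of B (F : 'I_n.+1 -> label nat B) : size (word_of F) = n.
Proof. by rewrite size_map size_enum_ord. Qed.

Lemma gap_label_word_of B (F : 'I_n.+1 -> label nat B) i :
  F ord0 = Half -> gap_label (word_of F) i = F i.
Proof.
move=> F0; rewrite /gap_label; case: (unliftP ord0 i) => [j ->|->] //=.
by rewrite add0n (nth_map j) ?size_enum_ord // nth_ord_enum.
Qed.

Lemma gap_label_eq B (w w' : seq (label nat B)) : size w = n -> size w' = n ->
  (forall i, gap_label w i = gap_label w' i) -> w = w'.
Proof.
move=> sw sw' ww'; apply: (@eq_from_nth _ Half) => [|i]; rewrite sw // => ltin.
exact: (ww' (lift ord0 (Ordinal ltin))).
Qed.

Lemma mem_gap_label (B : eqType) (w : seq (label nat B)) l : size w = n ->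
  reflect (exists i, gap_label w i = l) (l \in Half :: w).
Proof.
move=> sw; apply: (iffP (nthP Half)) => [[i lti <-]|[i <-]].
  by rewrite /= sw in lti; exists (Ordinal lti).
by exists i; rewrite //= sw.
Qed.

Lemma mem_painted_ranks (B : eqType) (w : seq (label nat B)) k : size w = n ->
  reflect (exists i, gap_label w i = Painted k) (k \in pmap (@painted_rank B) w).
Proof.
move=> sw; have -> : (k \in pmap (@painted_rank B) w) = (Painted k \in Half :: w).
  by rewrite inE /=; elim: (w) => //= -[j||b] s IHs; rewrite !inE IHs.
exact: mem_gap_label.
Qed.

Lemma mem_unpainted_ranks (w : seq (label nat nat)) k : size w = n ->
  reflect (exists i, gap_label w i = Unpainted k) (k \in pmap (@unpainted_rank nat) w).
Proof.
move=> sw; have -> : (k \in pmap (@unpainted_rank nat) w) = (Unpainted k \in Half :: w).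
  by rewrite inE /=; elim: (w) => //= -[j||b] s IHs; rewrite !inE IHs.
exact: mem_gap_label.
Qed.

(** Increasing for [ltW], in the order in which [pi] lists the corresponding blocks. *)
Definition label_range (a b : nat) : seq (label nat nat) :=
  map Painted (iota 0 a) ++ Half :: map Unpainted (iota 0 b).

Lemma label_range_lt a b : pairwise ltW (label_range a b).
Proof.
have iota_lt k : pairwise ltn (iota 0 k).
  by rewrite -sorted_pairwise ?iota_ltn_sorted //; apply: ltn_trans.
rewrite /label_range pairwise_cat /= !pairwise_map !iota_lt !andbT.
apply/andP; split; last by apply/allP => _ /mapP[k _ ->].
apply/allrelP => _ y /mapP[j _ ->]; rewrite inE.
by case/predU1P=> [->|/mapP[k _ ->]].
Qed.

Lemma mem_label_range a b l :
  (l \in label_range a b) =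
  match l with Painted k => k < a | Half => true | Unpainted k => k < b end.
Proof.
rewrite mem_cat inE.
have P k : (Painted k \in (map Painted (iota 0 a) : seq (label nat nat))) = (k < a).
  by rewrite mem_map ?mem_iota // => ? ? [].
have U k : (Unpainted k \in (map Unpainted (iota 0 b) : seq (label nat nat))) = (k < b).
  by rewrite mem_map ?mem_iota // => ? ? [].
case: l => [k||k]; rewrite ?P ?U ?orbT //=.
  by rewrite orbC; case: mapP => [[]|].
by case: mapP => [[]|].
Qed.

Lemma W_predP t :
  reflect [/\ increasing ltW t, size (word t) = n,
     exists a, forall k, k < a <-> exists i, gap_label (word t) i = Painted k
   & exists b, forall k, k < b <-> exists i, gap_label (word t) i = Unpainted k]
  (W_pred n t).
Proof.
rewrite W_predE; apply: (iffP and4P).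
  case=> -> /eqP st nP nU; split=> //.
    exists (size (undup (pmap (@painted_rank _) (word t)))) => k.
    by rewrite -mem_normal_levels //; split=> /mem_painted_ranks; apply.
  exists (size (undup (pmap (@unpainted_rank _) (word t)))) => k.
  by rewrite -mem_normal_levels //; split=> /mem_unpainted_ranks; apply.
case=> -> st [a aP] [b bP]; split=> //; first exact/eqP.
  by apply: (@normal_levels_initial _ a) => k; apply/mem_painted_ranks/idP => // /aP.
by apply: (@normal_levels_initial _ b) => k; apply/mem_unpainted_ranks/idP => // /bP.
Qed.

Lemma X_predP t :
  reflect [/\ increasing ltX t, size (word t) = n
   & exists a, forall k, k < a <-> exists i, gap_label (word t) i = Painted k]
  (X_pred n t).
Proof.
rewrite X_predE; apply: (iffP and3P).
  case=> -> /eqP st nP; split=> //.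
  exists (size (undup (pmap (@painted_rank _) (word t)))) => k.
  by rewrite -mem_normal_levels //; split=> /mem_painted_ranks; apply.
case=> -> st [a aP]; split=> //; first exact/eqP.
by apply: (@normal_levels_initial _ a) => k; apply/mem_painted_ranks/idP => // /aP.
Qed.

Lemma label_at_gap_end (B : eqType) (t : tree (label nat B)) (i : 'I_n.+1) :
  plane_tree t -> size (word t) = n -> 0 < i ->
  label_at t (gap_end t i) = Some (gap_label (word t) i).
Proof.
move=> plane_t st i_gt0; rewrite (label_gap_end Half) ?st ?i_gt0 //=; last first.
  by rewrite -ltnS.
by rewrite /gap_label; case: (val i) i_gt0.
Qed.

(** The value [Half] at index 0 puts 0 into the middle block, as [pi] does; at the other indices
    [gap_label] is the label of the node where the gap ends. *)
Lemma pi_fibers t : W_pred n t -> exists a b,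
  pi n t = map (fiber (gap_label (word t))) (label_range a b) /\
  forall l, l \in label_range a b <-> exists i, gap_label (word t) i = l.
Proof.
rewrite W_predE => /and4P[/andP[plane_t _] /eqP st nP nU].
exists (size (levels t (painted_level t))), (size (levels t (unpainted_level t))).
rewrite !(perm_size (levels_word plane_t (painted_levelE t))).
rewrite !(perm_size (levels_word plane_t (unpainted_levelE t))).
split=> [|l]; last first.
  rewrite mem_label_range; case: l => [k||k].
  - by rewrite -mem_normal_levels //; split=> /mem_painted_ranks; apply.
  - by split=> // _; exists ord0.
  - by rewrite -mem_normal_levels //; split=> /mem_unpainted_ranks; apply.
rewrite /label_range map_cat map_cons -!map_comp.
rewrite /pi !(perm_size (levels_word plane_t (painted_levelE t))).
rewrite !(perm_size (levels_word plane_t (unpainted_levelE t))).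
congr (_ ++ _ :: _); [apply: eq_map => k| |apply: eq_map => k]; apply/setP => i;
  rewrite !inE; have [/(@ord_inj _ _ ord0) -> //|i_gt0] := posnP i.
- by rewrite painted_levelE label_at_gap_end //; case: gap_label.
- rewrite /half_at label_at_gap_end // -val_eqE /= gtn_eqF //.
  by case: gap_label.
- by rewrite unpainted_levelE label_at_gap_end //; case: gap_label.
Qed.

Lemma refines_pi s t : W_pred n s -> W_pred n t ->
  refines (pi n s) (pi n t) <->
  (forall i j : 'I_n.+1, ltW (gap_label (word t) i) (gap_label (word t) j) ->
                         ltW (gap_label (word s) i) (gap_label (word s) j)).
Proof.
move=> /pi_fibers[a [b [-> s_ls]]] /pi_fibers[a' [b' [-> t_ls]]].
exact: (refines_fibers ltW_irr ltW_trans ltW_total (label_range_lt a b)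
  (label_range_lt a' b') s_ls t_ls).
Qed.
End GapLabels.

(** * Tubings of the star *)

Section StarTubes.
Variable n : nat.

(** Every edge of the star has 0 as an end, so no edge lies inside a set avoiding 0. *)
Lemma star_tubeE (u : {set star n}) :
  tube u = (ord0 \in u) || [exists i : 'I_n.+1, u == [set i]].
Proof.
have single (i : 'I_n.+1) : tube ([set i] : {set star n}).
  apply/andP; split; first by apply/set0Pn; exists i; rewrite inE.
  apply/forall_inP => x; rewrite inE => /eqP ->.
  by apply/forall_inP => y; rewrite inE => /eqP ->; apply: connect0.
have [u0|not_u0] /= := boolP (ord0 \in u).
  apply/andP; split; first by apply/set0Pn; exists ord0.
  set e' := [rel a b | _].
  have to0 x : x \in u -> connect e' x ord0 /\ connect e' ord0 x.
    move=> ux; have [->|x0] := eqVneq x ord0; first by split; apply: connect0.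
    by split; apply: connect1; rewrite /e' /= ux u0 /star_edge /= x0 ?eqxx ?orbT.
  apply/forall_inP => x /to0[x0 _]; apply/forall_inP => y /to0[_ y0].
  exact: connect_trans x0 y0.
apply/idP/existsP => [/andP[/set0Pn[i ui] /forall_inP conn]|[i /eqP ->]]; last exact: single.
exists i; rewrite eqEsubset sub1set ui andbT; apply/subsetP => j uj; rewrite inE.
(* The first edge of a nonempty path would put 0 into [u]. *)
have /forall_inP/(_ j uj)/connectP[[|k p] /= pth ->] := conn i ui; first by [].
case/andP: pth => /and3P[_ uk /orP[]] /andP[/eqP e0] _ _.
  by rewrite e0 (negPf not_u0) in ui.
by rewrite e0 (negPf not_u0) in uk.
Qed.

Implicit Types F G : 'I_n.+1 -> label nat unit.

(** Strictness keeps equally labelled indices together, so these sets are unions of top blocks. *)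
Definition up_set F (A : {set 'I_n.+1}) : bool :=
  [forall i in A, forall j, (j \notin A) ==> ltX (F j) (F i)].

Lemma up_setP F (A : {set 'I_n.+1}) :
  reflect (forall i j, i \in A -> j \notin A -> ltX (F j) (F i)) (up_set F A).
Proof.
apply: (iffP forall_inP) => H i; first by move=> j iA; move/(_ i iA)/forallP/(_ j)/implyP: H.
by move=> iA; apply/forallP => j; apply/implyP; apply: H.
Qed.

Definition tubing_set F : {set {set star n}} :=
  [set A : {set 'I_n.+1} | (ord0 \in A) && up_set F A
     || [exists i, (F i == Unpainted tt) && (A == [set i])]].

Lemma mem_tubing_set0 F (A : {set star n}) : F ord0 = Half -> ord0 \in A ->
  (A \in tubing_set F) = up_set F A.
Proof.
move=> F0 A0; rewrite inE A0 /= orbC; case: existsP => //= -[i /andP[/eqP Fi /eqP e]].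
by move: A0; rewrite e inE => /eqP i0; rewrite -i0 F0 in Fi.
Qed.

Lemma mem_tubing_set1 F (i : 'I_n.+1) : i != ord0 ->
  ([set i] \in tubing_set F) = (F i == Unpainted tt).
Proof.
move=> i0; rewrite inE inE eq_sym (negPf i0) /=.
apply/existsP/idP => [[j /andP[Fj /eqP/set1_inj ->]] //|Fi].
by exists i; rewrite Fi /=.
Qed.

(** Up-sets containing 0 form a chain and contain all unpainted indices. Two distinct unpainted
    singletons have a two-element union avoiding 0, which is no tube. *)
Lemma tubing_setP F : F ord0 = Half -> tubing (tubing_set F).
Proof.
move=> F0; apply/and3P; split.
- apply/forall_inP => A; rewrite inE star_tubeE => /orP[/andP[-> //]|].
  by case/existsP=> i /andP[_ iA]; apply/orP; right; apply/existsP; exists i.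
- have up_single (A : {set star n}) i :
      ord0 \in A -> up_set F A -> F i = Unpainted tt -> i \in A.
    move=> A0 /up_setP A_up Fi; apply: contraT => /(A_up _ _ A0).
    by rewrite Fi F0.
  apply/forall_inP => A; rewrite inE => A_U; apply/forall_inP => B; rewrite inE.
  rewrite /compatible; case/orP: A_U => [/andP[A0 A_up]|/existsP[i /andP[/eqP Fi /eqP ->]]].
    case/orP=> [/andP[B0 B_up]|/existsP[i /andP[/eqP Fi /eqP ->]]]; last first.
      by rewrite [_ \subset A]sub1set (up_single A i) ?orbT.
    have [//|/subsetPn[i iA niB]] /= := boolP (A \subset B).
    apply/orP; left; apply/subsetP => j jB; apply: contraT => njA.
    move/up_setP: A_up => /(_ i j iA njA); move/up_setP: B_up => /(_ j i jB niB).
    by move=> /ltX_trans H /H; rewrite ltX_irr.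
  case/orP=> [/andP[B0 B_up]|/existsP[j /andP[/eqP Fj /eqP ->]]].
    by rewrite sub1set (up_single B i).
  have [->|neq] := eqVneq i j; first by rewrite subxx.
  apply/or3P/Or33; rewrite disjoints1 inE neq star_tubeE !inE.
  have ne0 k : F k = Unpainted tt -> (ord0 == k) = false.
    by move=> Fk; apply: contra_eqF Fk => /eqP <-; rewrite F0.
  rewrite !ne0 //=; apply/negP => /existsP[k /eqP/setP ijk].
  move: (ijk i) (ijk j); rewrite !inE !eqxx orbT => /esym/eqP ik /esym/eqP jk.
  by rewrite ik jk eqxx in neq.
- rewrite mem_tubing_set0 ?inE //; apply/up_setP => i j.
  by rewrite !inE.
Qed.

(** Indices outside an up-set containing 0 are painted, so the up-sets see only comparisons whose
    smaller side is painted; the singletons see which indices are unpainted. *)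
Lemma tubing_set_subset F G : F ord0 = Half -> G ord0 = Half ->
  tubing_set F \subset tubing_set G <->
  (forall i j k, F i = Painted k -> ltX (F i) (F j) -> ltX (G i) (G j)) /\
  (forall i, F i = Unpainted tt -> G i = Unpainted tt).
Proof.
move=> F0 G0; split=> [/subsetP FG|[FG_painted FG_unpainted]].
  split=> [i j k Fi Fij|i Fi].
    (* The up-set just above [i]; it separates [i] from [j] and contains 0 because [i] is
       painted. *)
    pose A : {set star n} := [set l | ltX (F i) (F l)].
    have A0 : ord0 \in A by rewrite inE Fi F0.
    have /FG : A \in tubing_set F.
      rewrite mem_tubing_set0 //; apply/up_setP => l m; rewrite !inE => Fl.
      apply: contraNT => Fml; have [<- //|neq] := eqVneq (F l) (F m).
      have /orP[/(ltX_trans Fl) //|] := ltX_total neq.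
      by rewrite (negPf Fml).
    rewrite mem_tubing_set0 // => /up_setP; apply; rewrite inE // ltX_irr //.
  have i0 : i != ord0 by apply: contra_eq_neq Fi => ->; rewrite F0.
  by have := FG [set i]; rewrite !mem_tubing_set1 // Fi => /(_ isT)/eqP.
apply/subsetP => A; rewrite inE => /orP[/andP[A0 /up_setP A_up]|].
  rewrite mem_tubing_set0 //; apply/up_setP => i j iA njA.
  have := A_up _ _ A0 njA; rewrite F0; case Fj: (F j) => [k||] // _.
  by apply: (FG_painted _ _ k) => //; apply: A_up.
case/existsP=> i /andP[/eqP Fi /eqP ->].
have i0 : i != ord0 by apply: contra_eq_neq Fi => ->; rewrite F0.
by rewrite mem_tubing_set1 // FG_unpainted.
Qed.

(** Induction on the level: since the levels of [F] are consecutive, an index at level [k.+1] lies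
    above one at level [k], and [G] keeps this comparison strict. *)
Lemma painted_level_le F G a : F ord0 = Half -> G ord0 = Half ->
  (forall k, k < a <-> exists i, F i = Painted k) ->
  tubing_set F \subset tubing_set G ->
  forall k i, F i = Painted k -> exists2 k', k <= k' & G i = Painted k'.
Proof.
move=> F0 G0 aP /(tubing_set_subset F0 G0)[FG _].
have G_painted i k : F i = Painted k -> exists k', G i = Painted k'.
  move=> Fi; have := FG i ord0 k Fi; rewrite Fi F0 G0 => /(_ isT).
  by case: (G i) => [k'||] // _; exists k'.
elim=> [|k IHk] i Fi; have [k' Gi] := G_painted _ _ Fi; exists k' => //.
have /aP[i' Fi'] : k < a by apply: ltn_trans (ltnSn k) _; apply/aP; exists i.
have [k'' kk'' Gi'] := IHk _ Fi'.
have := FG i' i k Fi'; rewrite Fi' Fi Gi Gi' /= => /(_ (ltnSn k)).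
exact: leq_ltn_trans.
Qed.

(** Inclusion both ways bounds each painted level from both sides; consecutive numbering thus makes
    the labels, not only their order, unique. *)
Lemma tubing_set_inj F G a b : F ord0 = Half -> G ord0 = Half ->
  (forall k, k < a <-> exists i, F i = Painted k) ->
  (forall k, k < b <-> exists i, G i = Painted k) ->
  tubing_set F = tubing_set G -> forall i, F i = G i.
Proof.
move=> F0 G0 aP bP FG i.
have sFG : tubing_set F \subset tubing_set G by rewrite FG.
have sGF : tubing_set G \subset tubing_set F by rewrite FG.
have leF := painted_level_le F0 G0 aP sFG; have leG := painted_level_le G0 F0 bP sGF.
have /(tubing_set_subset F0 G0)[_ uF] := sFG.
have /(tubing_set_subset G0 F0)[_ uG] := sGF.
case Fi: (F i) => [k||[]]; last by rewrite uF.
  have [k' kk' Gi] := leF _ _ Fi; have [k'' kk'' ] := leG _ _ Gi.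
  rewrite Fi Gi => -[e]; rewrite -e in kk''.
  by congr Painted; apply/eqP; rewrite eqn_leq kk' kk''.
case Gi: (G i) => [k||[]] //; last by rewrite uG in Fi.
by have [k' _] := leG _ _ Gi; rewrite Fi.
Qed.
End StarTubes.

(** * Growth steps *)

Section Growth.
Variable n : nat.
Implicit Types x y : X n.

Definition gap_labels x : 'I_n.+1 -> label nat unit := gap_label (word (val x)).

Lemma gap_labels_levels x :
  exists a, forall k, k < a <-> exists i, gap_labels x i = Painted k.
Proof. by have /X_predP[] := valP x. Qed.

Lemma gap_labels_inj x y : (forall i, gap_labels x i = gap_labels y i) -> x = y.
Proof.
have /X_predP[x_inc sx _] := valP x; have /X_predP[y_inc sy _] := valP y.
move=> /(gap_label_eq sx sy) xy; apply: val_inj.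
by rewrite -(wordK ltX_irr ltX_trans x_inc) xy wordK //; [apply: ltX_irr | apply: ltX_trans].
Qed.

Lemma gap_label_forget (w : seq (label nat nat)) (i : 'I_n.+1) :
  gap_label (map forget_level w) i = forget_level (gap_label w i).
Proof.
rewrite /gap_label -[Half :: _]/(map forget_level (Half :: w)).
have [lti|lei] := ltnP i (size (Half :: w)); first by rewrite (nth_map Half).
by rewrite !nth_default // size_map.
Qed.

Lemma gap_labels_forget (t : W n) x i : forget (val t) = val x ->
  gap_labels x i = forget_level (gap_label (word (val t)) i).
Proof.
move=> tx; rewrite /gap_labels -tx word_forget ?gap_label_forget //.
by have /W_predP[/andP[]] := valP t.
Qed.

(** The tree built from [F] forgets to an increasing tree with the word of [x], hence to [x]. *)
Lemma W_with_labels (F : 'I_n.+1 -> label nat nat) x b : F ord0 = Half ->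
  (forall i, forget_level (F i) = gap_labels x i) ->
  (forall k, k < b <-> exists i, F i = Unpainted k) ->
  exists t : W n, forget (val t) = val x /\
                  forall i, gap_label (word (val t)) i = F i.
Proof.
move=> F0 Fx bP; pose t := build ltW (word_of F).
have wt : word t = word_of F by apply: buildK; [apply: ltW_trans | apply: ltW_total].
have t_inc : increasing ltW t by apply: increasing_build; [apply: ltW_trans | apply: ltW_total].
have tF i : gap_label (word t) i = F i by rewrite wt gap_label_word_of.
have t_W : W_pred n t.
  apply/W_predP; split=> //; first by rewrite wt size_word_of.
    have [a aP] := gap_labels_levels x; exists a => k.
    split=> [/aP[i xi]|[i tk]].
      by exists i; move: xi; rewrite tF -Fx; case: (F i) => //= ? [->].
    by apply/aP; exists i; rewrite -Fx -tF tk.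
  exists b => k; split=> [/bP[i Fi]|[i tk]]; first by exists i; rewrite tF.
  by apply/bP; exists i; rewrite -tF.
exists (exist _ t t_W); split=> //=.
have /andP[t_plane _] := t_inc.
have /X_predP[x_inc sx _] := valP x.
rewrite -(wordK ltX_irr ltX_trans x_inc).
rewrite -[LHS](wordK ltX_irr ltX_trans); last exact: increasing_forget.
congr build; apply: (@gap_label_eq n) => //.
  by rewrite word_forget // size_map wt size_word_of.
by move=> i; rewrite word_forget // gap_label_forget tF Fx.
Qed.

Lemma growth_stepE x y :
  growth_step x y <-> tubing_set (gap_labels x) \subset tubing_set (gap_labels y).
Proof.
split=> [[t [s [tx sy /(refines_pi (valP s) (valP t)) ts]]]|].
  apply/tubing_set_subset => //; split=> [i j k|i].
    rewrite !(gap_labels_forget _ tx) !(gap_labels_forget _ sy).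
    (* Comparison with index 0, labelled [Half], shows that a gap painted in [t] stays painted in
       [s]. *)
    have := ts i j; have := ts i ord0.
    case: (gap_label (word (val t)) i) => //= k' /(_ isT) + + _.
    case: (gap_label (word (val s)) i) => //= k'' _.
    case: (gap_label (word (val t)) j) => [j'||j'] //= tsij H; have := tsij H;
      by case: (gap_label (word (val s)) j).
  rewrite (gap_labels_forget _ tx) (gap_labels_forget _ sy).
  have := ts ord0 i; case: (gap_label (word (val t)) i) => //= b /(_ isT) + _.
  by case: (gap_label (word (val s)) i).
move/tubing_set_subset => /(_ erefl erefl)[xy_painted xy_unpainted].
pose lift c (l : label nat unit) : label nat nat :=
  match l with Painted k => Painted k | Half => Half | Unpainted _ => Unpainted c end.
have liftK c l : forget_level (lift c l) = l by case: l => // -[].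
(* The lift of y orders its new unpainted gaps before the old ones. *)
pose old i := gap_labels x i == Unpainted tt.
pose new i := (gap_labels y i == Unpainted tt) && ~~ old i.
(* Old gaps move to level 1 only if level 0 is taken by new ones, so that the numbering stays
   consecutive. *)
pose Fs i := lift ([exists j, new j] && old i : nat) (gap_labels y i).
(* A single unpainted level in [t] leaves no comparison between unpainted gaps to be preserved. *)
have [t [tx tF]] : exists t : W n, forget (val t) = val x /\
    forall i, gap_label (word (val t)) i = lift 0 (gap_labels x i).
  apply: (@W_with_labels _ _ [exists i, old i]) => // k.
  split=> [|[i]]; last first.
    by case xi: (gap_labels x i) => [||[]] //= [<-]; case: existsP => // -[]; exists i; apply/eqP.
  by case: existsP => [[i /eqP xi]|//]; case: k => // _; exists i; rewrite xi.
have [s [sy sF]] : exists s : W n, forget (val s) = val y /\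
    forall i, gap_label (word (val s)) i = Fs i.
  apply: (@W_with_labels _ _ ([exists i, old i] + [exists i, new i])) => [//|i|k].
    exact: liftK.
  have old_y i : old i -> gap_labels y i = Unpainted tt by move/eqP/xy_unpainted.
  rewrite /Fs; have [/existsP[j newj]|no_new] /= := boolP [exists j, new j].
    have yj : gap_labels y j = Unpainted tt by case/andP: newj => /eqP.
    have oldj : old j = false by case/andP: newj => _ /negPf.
    have [/existsP[i oldi]|no_old] := boolP [exists i, old i].
      split=> [|[l]]; last by case: (gap_labels y l) => //= _ [<-]; case: (old l).
      by case: k => [|[|//]] _; [exists j; rewrite oldj yj | exists i; rewrite oldi old_y].
    split=> [|[l]]; first by case: k => // _; exists j; rewrite oldj yj.
    case: (gap_labels y l) => //= _ [<-]; case oldl: (old l) => //.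
    by case/existsP: no_old; exists l.
  split=> [|[l]]; last first.
    case yl: (gap_labels y l) => [||[]] //= [<-]; rewrite addn0 lt0b.
    apply/existsP; exists l; apply: contraT => oldl; case/existsP: no_new.
    by exists l; rewrite /new yl oldl.
  case: existsP => [[i oldi]|//]; case: k => // _; exists i.
  by rewrite old_y.
exists t, s; split=> //; apply/(refines_pi (valP s) (valP t)) => i j.
rewrite !tF !sF /Fs; case xi: (gap_labels x i) => [k||[]] //=.
- move=> tij; have := xy_painted i j k xi; rewrite xi.
  have : ltX (Painted k) (gap_labels x j) by case: (gap_labels x j) tij.
  move=> -> /(_ isT); case: (gap_labels y i) => [?||[]]; by case: (gap_labels y j) => [?||[]].
- case xj: (gap_labels x j) => [||[]] // _; rewrite (xy_unpainted j xj).
  case yi: (gap_labels y i) => [?||[]] //=.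
  (* Here [i] passes from half-painted to unpainted, so it is new and must precede the old gap [j];
     this dictates the order chosen in [Fs]. *)
  have -> : [exists j, new j] by apply/existsP; exists i; rewrite /new /old yi xi.
  by rewrite /old xi xj.
- by case: (gap_labels x j).
Qed.

(** Inclusion is reflexive and transitive, so any sequence of growth steps amounts to a single
    one. *)
Lemma growth_leE x y :
  growth_le y x <-> tubing_set (gap_labels x) \subset tubing_set (gap_labels y).
Proof.
split=> [|/growth_stepE]; last exact: rt_step.
elim=> {x y} [x y /growth_stepE //|x|x y z _ xy _ yz]; first exact: subxx.
exact: subset_trans xy yz.
Qed.
End Growth.

(** * From a tubing back to a tree *)

Section Inverse.
Variable n : nat.

Section Normalize.
Variable F : 'I_n.+1 -> label nat unit.
Hypothesis F0 : F ord0 = Half.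

Definition used_levels : seq nat := sort leq (undup (pmap (@painted_rank unit) (codom F))).

(** Trees need painted levels numbered consecutively from 0, whereas a tubing sees only their
    order. *)
Definition normalize (i : 'I_n.+1) : label nat unit :=
  if F i is Painted k then Painted (index k used_levels) else F i.

Lemma mem_used_levels k : k \in used_levels <-> exists i, F i = Painted k.
Proof.
rewrite mem_sort mem_undup mem_pmap; split.
  by case/mapP=> l /codomP[i ->]; case Fi: (F i) => [k'||] // [->]; exists i.
by case=> i Fi; apply/mapP; exists (Painted k); rewrite // -Fi codom_f.
Qed.

Lemma used_levels_ltn : sorted ltn used_levels.
Proof. by rewrite ltn_sorted_uniq_leq sort_uniq undup_uniq sort_sorted //; apply: leq_total. Qed.

Lemma ltX_normalize i j : ltX (normalize i) (normalize j) = ltX (F i) (F j).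
Proof.
have mono k l : k \in used_levels -> l \in used_levels ->
    index k used_levels < index l used_levels -> k < l.
  exact: (sorted_ltn_index ltn_trans used_levels_ltn).
rewrite /normalize; case Fi: (F i) => [k||]; case Fj: (F j) => [l||] //=.
have kv : k \in used_levels by apply/mem_used_levels; exists i.
have lv : l \in used_levels by apply/mem_used_levels; exists j.
apply/idP/idP => [|kl]; first exact: mono.
case: (ltngtP (index k _) (index l _)) => // [/mono|/index_inj e].
  by move=> /(_ lv kv)/(ltn_trans kl); rewrite ltnn.
by rewrite (e 0 kv lv) ltnn in kl.
Qed.

Lemma tubing_set_normalize : tubing_set normalize = tubing_set F.
Proof.
have N0 : normalize ord0 = Half by rewrite /normalize F0.
apply/eqP; rewrite eqEsubset; apply/andP; split;
  apply/tubing_set_subset => //; split=> [i j k _|i]; rewrite ?ltX_normalize //.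
  by rewrite /normalize; case: (F i).
by rewrite /normalize => ->.
Qed.

(** The witness is kept as data because it defines the map from tubings to trees. *)
Lemma X_with_labels : {x : X n | forall i, gap_labels x i = normalize i}.
Proof.
pose t := build ltX (word_of normalize).
have wt : word t = word_of normalize by apply: buildK; [apply: ltX_trans | apply: ltX_total].
have tN i : gap_label (word t) i = normalize i.
  by rewrite wt gap_label_word_of // /normalize F0.
have t_X : X_pred n t.
  apply/X_predP; split; last 1 first.
  - exists (size used_levels) => k; split=> [ltk|[i]].
      have /mem_used_levels[i Fi] := mem_nth 0 ltk.
      exists i; rewrite tN /normalize Fi index_uniq // sort_uniq; exact: undup_uniq.
    rewrite tN /normalize; case Fi: (F i) => [l||] // [<-].
    by rewrite index_mem; apply/mem_used_levels; exists i.
  - by apply: increasing_build; [apply: ltX_trans | apply: ltX_total].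
  - by rewrite wt size_word_of.
by exists (exist _ t t_X).
Qed.
End Normalize.

Variable U : {set {set star n}}.
Hypothesis U_tubing : tubing U.

Definition nested (i : 'I_n.+1) : {set {set star n}} :=
  [set A in U | (ord0 \in A) && (i \in A)].

(** The tubes containing 0 form a chain, so counting those that contain [i] orders the indices. The
    singleton of 0 may itself be a member of that chain and must not make 0 unpainted. *)
Definition tubing_labels (i : 'I_n.+1) : label nat unit :=
  if ([set i] \in U) && (i != ord0) then Unpainted tt
  else if nested i == nested ord0 then Half else Painted #|nested i|.

Lemma tubing_labels0 : tubing_labels ord0 = Half.
Proof. by rewrite /tubing_labels eqxx andbF eqxx. Qed.

Lemma nested_sub0 i : nested i \subset nested ord0.
Proof. by apply/subsetP => A; rewrite !inE => /and3P[-> -> _]. Qed.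

(** Strict comparisons from a painted index are exactly separations by a tube of [U] containing 0;
    the chain property then shows that every up-set containing 0 is already in [U]. *)
Lemma tubing_labelsE : tubing_set tubing_labels = U.
Proof.
have /and3P[/forall_inP U_tube /forall_inP U_comp U_full] := U_tubing.
have comp A B : A \in U -> B \in U -> compatible A B.
  by move=> AU BU; have /forall_inP := U_comp A AU; apply.
have chain A B : A \in U -> B \in U -> ord0 \in A -> ord0 \in B ->
    (A \subset B) || (B \subset A).
  move=> AU BU A0 B0; have /or3P[->|->|/andP[]] := comp _ _ AU BU; rewrite ?orbT //.
  by move/disjoint_setI0/setP/(_ ord0); rewrite !inE A0 B0.
(* Otherwise the two tubes would be disjoint with a union containing 0, which is a tube. *)
have single A i : A \in U -> ord0 \in A -> [set i] \in U -> i \in A.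
  move=> AU A0 iU; have /or3P[|/subsetP/(_ _ A0)|/andP[_]] := comp _ _ iU AU.
  - by rewrite sub1set.
  - by rewrite inE => /eqP <-.
  - by rewrite star_tubeE inE A0 orbT.
(* By the chain property a tube with 0 and [i] contains [A], hence [j]; [A] itself makes the
   inclusion of [nested i] in [nested j] strict. *)
have labels_lt A i j : A \in U -> ord0 \in A -> j \in A -> i \notin A ->
    ltX (tubing_labels i) (tubing_labels j).
  move=> AU A0 jA niA; have i_nested : A \notin nested i by rewrite inE (negPf niA) !andbF.
  have lt_ij : #|nested i| < #|nested j|.
    apply/proper_card/properP; split; last by exists A; rewrite // inE AU A0.
    apply/subsetP => B; rewrite !inE => /and3P[BU B0 iB]; rewrite BU B0 /=.
    by case/orP: (chain A B AU BU A0 B0) => /subsetP sub; [apply: sub|rewrite sub in niA].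
  rewrite /tubing_labels; case: ifP => [/andP[/(single _ _ AU A0)]|_].
    by rewrite (negPf niA).
  case: eqP => [e|_]; first by rewrite e inE AU A0 in i_nested.
  by case: ifP => // _; case: ifP.
(* A larger label at [j] prevents [nested j] from lying inside [nested i]; a tube in the difference
   is the separating one. *)
have lt_labels i j k : tubing_labels i = Painted k ->
    ltX (tubing_labels i) (tubing_labels j) ->
    exists A, [/\ A \in U, ord0 \in A, j \in A & i \notin A].
  rewrite {1}/tubing_labels; case: ifP => // _; case: eqP => // /eqP neq [ik].
  have ne0 : ~~ (nested ord0 \subset nested i).
    by apply: contra neq => sub; rewrite eqEsubset nested_sub0.
  move=> ij; suff /subsetPn[A] : ~~ (nested j \subset nested i).
    by rewrite !inE => /and3P[AU A0 jA]; rewrite AU A0 => niA; exists A.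
  move: ij; rewrite {1}/tubing_labels; case: ifP => [/andP[i_single i0]|not_single].
    by case: (tubing_labels j) => [?||[]].
  rewrite (negPf neq) /tubing_labels; case: ifP => [/andP[j_single j0] _|_].
    apply: contra ne0 => sub; apply: subset_trans sub.
    by apply/subsetP => A; rewrite !inE => /and3P[AU A0 _]; rewrite AU A0 (single A).
  case: eqP => [-> //|_] /= lt_ij; apply: contraL lt_ij => /subset_leq_card.
  by rewrite -leqNgt.
apply/setP => A; have [A0|A0] := boolP (ord0 \in A); last first.
  rewrite inE (negPf A0) /=; apply/existsP/idP => [[i /andP[lab_i /eqP ->]]|AU].
    by move: lab_i; rewrite /tubing_labels; case: ifP => [/andP[]//|_]; case: ifP.
  have := U_tube A AU; rewrite star_tubeE (negPf A0) => /existsP[i /eqP Ai].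
  exists i; rewrite Ai eqxx andbT /tubing_labels -Ai AU /=.
  by move: A0; rewrite Ai inE eq_sym => ->.
rewrite mem_tubing_set0 ?tubing_labels0 //; apply/up_setP/idP => [A_up|AU i j]; last first.
  exact: labels_lt.
(* The smallest tube [B] of [U] containing [A] is [A] itself: an extra index [i] of [B] leads to a
   contradiction. *)
pose containing (B : {set star n}) := (B \in U) && (A \subset B).
have [B /andP[BU AB] B_min] : exists2 B, containing B & forall C, containing C -> #|B| <= #|C|.
  have full : containing setT by rewrite /containing U_full subsetT.
  by case: (arg_minnP (fun C : {set star n} => #|C|) full) => B; exists B.
have [BA|/subsetPn[i iB niA]] := boolP (B \subset A).
  by have -> : A = B by apply/eqP; rewrite eqEsubset AB.
have := A_up _ _ A0 niA; rewrite tubing_labels0.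
case lab_i: (tubing_labels i) => [k||] // _.
have above a : a \in A -> exists C, [/\ C \in U, ord0 \in C, a \in C & i \notin C].
  by move=> aA; apply: (lt_labels i a k lab_i); apply: A_up.
(* The largest tube with 0 avoiding [i] contains, by the chain property, all tubes given by [above],
   hence [A]. Minimality of [B] then forces it to contain [B], although [i] is in [B]. *)
pose avoiding (D : {set star n}) := [&& D \in U, ord0 \in D & i \notin D].
have [D /and3P[DU D0 niD] D_max] :
    exists2 D, avoiding D & forall C, avoiding C -> #|C| <= #|D|.
  have [C [CU C0 _ niC]] := above _ A0.
  have C_avoid : avoiding C by apply/and3P.
  by case: (arg_maxnP (fun C : {set star n} => #|C|) C_avoid) => D; exists D.
have AD : A \subset D.
  apply/subsetP => a /above[C [CU C0 aC niC]].
  have leCD : #|C| <= #|D| by apply/D_max/and3P.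
  case/orP: (chain C D CU DU C0 D0) => [/subsetP-> //|DC].
  by have -> : D = C by apply/eqP; rewrite eqEcard DC.
have leBD : #|B| <= #|D| by apply/B_min/andP.
case/orP: (chain B D BU DU (subsetP AB _ A0) D0) => [/subsetP sub|DB].
  by rewrite sub in niD.
have e : D = B by apply/eqP; rewrite eqEcard DB.
by rewrite e iB in niD.
Qed.
End Inverse.

(** * The isomorphism of posets *)

Theorem theorem4p12 (n : nat) (hn : 1 <= n) :
  poset_isomorphic (@tub_le (star n)) (@growth_le n).
Proof.
pose toTub (x : X n) : Tub (star n) :=
  exist _ (tubing_set (gap_labels x)) (tubing_setP (erefl : gap_labels x ord0 = Half)).
pose toX (U : Tub (star n)) : X n := sval (X_with_labels (tubing_labels0 (val U))).
have toXK : cancel toX toTub.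
  move=> U; apply: val_inj => /=; rewrite -[RHS](tubing_labelsE (valP U)).
  rewrite -(tubing_set_normalize (tubing_labels0 (val U))).
  rewrite /toX; case: X_with_labels => x /= xN.
  by apply/setP => A; rewrite !inE /up_set; congr (_ && _ || _);
    [apply: eq_forallb => i; congr (_ ==> _); apply: eq_forallb => j|apply: eq_existsb => i];
    rewrite !xN.
(* [toX (toTub x)] and [x] have the same tubing by [toXK], and consecutive levels make the labels
   unique. *)
have toTubK : cancel toTub toX.
  move=> x; apply: gap_labels_inj.
  have [a aP] := gap_labels_levels (toX (toTub x)); have [b bP] := gap_labels_levels x.
  by apply: (tubing_set_inj erefl erefl aP bP); exact: (congr1 val (toXK (toTub x))).
split.
- split=> [U|U V W|U V]; rewrite /tub_le; first exact: subxx.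
    by move=> VU WV; apply: subset_trans WV VU.
  by move=> VU UV; apply: val_inj; apply/eqP; rewrite eqEsubset UV VU.
- split=> [x|y x z xy yz|y x /growth_leE xy /growth_leE yx]; first exact: rt_refl.
    exact: rt_trans yz xy.
  by apply: (can_inj toTubK); apply: val_inj; apply/eqP; rewrite eqEsubset xy yx.
exists toX; split; first by exists toTub.
have val_toX W : tubing_set (gap_labels (toX W)) = val W by exact: (congr1 val (toXK W)).
by move=> U V; have [] := growth_leE (toX V) (toX U); rewrite !val_toX.
Qed.
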